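(* Assume (A1)–(A3) from the context. Let PATA (described in the context) be run with parameters $\gamma^k\in(0,1]$ ($k\ge 0$), $\bar\tau^i>0$ and $\bar\varepsilon^i\ge 0$ ($i\ge 0$) satisfying $$\sum_{k=0}^\infty \gamma^k = \infty,\qquad \frac{\sum_{k=0}^\infty (\gamma^k)^2}{\sum_{k=0}^\infty \gamma^k} = 0,\qquad \frac{1}{\bar\tau^i}\downarrow 0,\qquad \sum_{i=0}^\infty \frac{1}{\bar\tau^i}=\infty,\qquad \bar\varepsilon^i=\frac{c}{(\bar\tau^i)^\beta},$$ with $\beta>1$ and $c>0$. Here the second condition means $\lim_{K\to\infty}\big(\sum_{k=0}^K(\gamma^k)^2\big)/\big(\sum_{k=0}^K\gamma^k\big)=0$. Then every limit point of the sequence $\{w^i\}$ generated by PATA is a solution of the nested variational inequality: find $x\in\mathrm{SOL}(F,Y)$ such that $G(x)^T(y-x)\ge 0$ for all $y\in\mathrm{SOL}(F,Y)$.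
   Context: Let $F,G:\mathbb R^n\to\mathbb R^n$ and $Y\subseteq\mathbb R^n$. $\mathrm{SOL}(F,Y)$ denotes the set of all $x\in Y$ with $F(x)^T(y-x)\ge 0$ for all $y\in Y$. Assumptions: (A1) $G$ is Lipschitz continuous with constant $L_G$ and monotone on $Y$ (i.e. $(G(x)-G(y))^T(x-y)\ge 0$ for all $x,y\in Y$). (A2) $F$ is Lipschitz continuous with constant $L_F$ and monotone on $Y$. (A3) $Y$ is nonempty, convex and compact. For $\tau>0$ let $\Phi_\tau(x)=F(x)+\frac1\tau G(x)$. $P_Y$ is the Euclidean projection onto $Y$. Projected Averaging Tikhonov Algorithm (PATA). Data: $\{\bar\varepsilon^i\}\subseteq[0,\infty)$, $\{\bar\tau^i\}\subseteq(0,\infty)$, $\gamma^k\in(0,1]$, $w^0=z^0=y^0\in Y$; initialize $i=0$, $l=0$. For $k=0,1,2,\ldots$: (S.1) set $\varepsilon^k=\bar\varepsilon^i$, $\tau^k=\bar\tau^i$; (S.2) set $y^{k+1}=P_Y\big(y^k-\gamma^{k-l}\Phi_{\tau^k}(y^k)\big)$; (S.3) set $z^{k+1}=\big(\sum_{j=l}^{k+1}\gamma^{j-l}y^j\big)/\big(\sum_{j=l}^{k+1}\gamma^{j-l}\big)$; (S.4) if $\min_{y\in Y}\Phi_{\tau^k}(z^{k+1})^T(y-z^{k+1})\ge-\varepsilon^k$, then set $w^{i+1}=z^{k+1}$, replace $i$ by $i+1$, and set $l=k+1$. Superscripts on $\gamma,y,z,w,\bar\tau,\bar\varepsilon,\tau,\varepsilon$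 are indices, except in $(\gamma^k)^2$ and $(\bar\tau^i)^\beta$, where the outer exponent is a power. *)

(* Defs.v *)
From HB Require Import structures.
From mathcomp Require Import all_boot all_order all_algebra.
From mathcomp Require Import all_classical all_reals all_analysis.

Set Implicit Arguments.
Unset Strict Implicit.
Unset Printing Implicit Defensive.

Import Order.TTheory GRing.Theory Num.Theory.
Import numFieldNormedType.Exports.

Local Open Scope classical_set_scope.
Local Open Scope ring_scope.

Definition dot (R : realType) (n : nat) (u v : 'rV[R]_n) : R :=
  \sum_(i < n) u 0 i * v 0 i.

(* The canonical norm on 'rV[R]_n is the sup norm, hence a separate Euclidean
   norm; the two induce the same topology. *)
Definition enorm (R : realType) (n : nat) (u : 'rV[R]_n) : R :=
  Num.sqrt (dot u u).

Definition elipschitz_in (R : realType) (n : nat) (L : R) (Y : set 'rV[R]_n)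
    (F : 'rV[R]_n -> 'rV[R]_n) : Prop :=
  forall x y, Y x -> Y y -> enorm (F x - F y) <= L * enorm (x - y).

Definition monotone_in (R : realType) (n : nat) (Y : set 'rV[R]_n)
    (F : 'rV[R]_n -> 'rV[R]_n) : Prop :=
  forall x y, Y x -> Y y -> 0 <= dot (F x - F y) (x - y).

Definition SOL (R : realType) (n : nat) (F : 'rV[R]_n -> 'rV[R]_n)
    (Y : set 'rV[R]_n) : set 'rV[R]_n :=
  [set x | Y x /\ forall y, Y y -> 0 <= dot (F x) (y - x)].

(* Junk value when [v] has no nearest point in [Y]; for [Y] nonempty, closed
   and convex the nearest point exists and is unique. *)
Definition proj (R : realType) (n : nat) (Y : set 'rV[R]_n) (v : 'rV[R]_n) :
    'rV[R]_n :=
  get [set p | Y p /\ forall q, Y q -> enorm (v - p) <= enorm (v - q)].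

Definition Phi (R : realType) (n : nat) (F G : 'rV[R]_n -> 'rV[R]_n) (tau : R)
    (x : 'rV[R]_n) : 'rV[R]_n :=
  F x + tau^-1 *: G x.

(* min_{y in Y} H(x)^T (y - x); the infimum is attained for [Y] nonempty and
   compact. *)
Definition VI_min (R : realType) (n : nat) (H : 'rV[R]_n -> 'rV[R]_n)
    (Y : set 'rV[R]_n) (x : 'rV[R]_n) : R :=
  inf [set dot (H x) (y - x) | y in Y].

(* [y], [z], [w] are the sequences y^k, z^k, w^i; [i k] and [l k] are the
   values of the counters i and l at the start of iteration k, so that
   eps^k = epsbar (i k) and tau^k = taubar (i k).
   If the test succeeded only finitely often, the remaining terms of [w] would
   be unconstrained: a claim about the limit points of an arbitrary such [w]
   therefore also covers the fact that the algorithm does produce an infinite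
   sequence. *)
Record PATA (R : realType) (n : nat) (F G : 'rV[R]_n -> 'rV[R]_n)
    (Y : set 'rV[R]_n) (gamma epsbar taubar : nat -> R)
    (y z w : nat -> 'rV[R]_n) (i l : nat -> nat) : Prop := MkPATA {
  PATA_init_in : Y (y 0%N) ;
  PATA_init_z : z 0%N = y 0%N ;
  PATA_init_w : w 0%N = y 0%N ;
  PATA_init_i : i 0%N = 0%N ;
  PATA_init_l : l 0%N = 0%N ;
  PATA_y : forall k, y k.+1 =
    proj Y (y k - gamma (k - l k)%N *: Phi F G (taubar (i k)) (y k)) ;
  PATA_z : forall k, z k.+1 =
    (\sum_(l k <= j < k.+2) gamma (j - l k)%N)^-1 *:
      (\sum_(l k <= j < k.+2) gamma (j - l k)%N *: y j) ;
  PATA_test : forall k,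
    if - epsbar (i k) <= VI_min (Phi F G (taubar (i k))) Y (z k.+1)
    then [/\ w (i k).+1 = z k.+1, i k.+1 = (i k).+1 & l k.+1 = k.+1]
    else i k.+1 = i k /\ l k.+1 = l k }.

(* Main.v *)
Require Import Defs.
From HB Require Import structures.
From mathcomp Require Import all_boot all_order all_algebra.
From mathcomp Require Import all_classical all_reals all_analysis.
From mathcomp Require Import ring lra.
Import Order.TTheory GRing.Theory Num.Theory.
Import numFieldNormedType.Exports.
Local Open Scope classical_set_scope.
Local Open Scope ring_scope.

(** The proof has two independent halves.

    Every stage of the algorithm ends.  While the counters [i] and [l] do not
    move, the iterates are projected steps for the single operator
    [H = Phi F G tau], which is monotone and Lipschitz on [Y].  Since projection
    onto [Y] brings a point closer to every [q] in [Y], the squared distances to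
    [q] telescope ([regret_bound]); monotonicity and division by the sum of the
    steps bound [H(q)^T (z - q)] at the averages [z] by a quantity governed by
    [1 / sum gamma] and [(sum gamma^2) / (sum gamma)], so it tends to at most 0
    ([weak_gap_vanishes]).  A cluster point of the averages in the compact set
    [Y] therefore solves the weak variational inequality for [H], hence the
    strong one by [minty], and as the gap is Lipschitz in the base point, the
    averages near it pass the test, whose tolerance is positive
    ([mean_approx_solution], [stage_test_succeeds]).  So every [w (m+1)] lies in
    [Y] and satisfies, for all [q] in [Y] ([PATA_w_gap]),
    [- eps_m <= F(w)^T (q - w) + tau_m^-1 G(w)^T (q - w)].

    The nested inequality holds in the limit.  As [tau_m^-1] and [eps_m] tend to
    0, what remains at a cluster point is the inequality for [F]
    ([limit_lower_level]).  If [q] solves the lower problem, monotonicity gives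
    [F(w)^T (q - w) <= 0]; dropping this term and multiplying by [tau_m] leaves
    [- eps_m tau_m <= G(w)^T (q - w)], and [eps_m tau_m] tends to 0 because
    [beta > 1] ([tolerance_vanishes], [limit_upper_level]). *)

(** * Euclidean geometry *)

Section Euclidean.
Context {R : realType} {n : nat}.
Implicit Types u v w : 'rV[R]_n.

Lemma dotC u v : dot u v = dot v u.
Proof. by apply: eq_bigr => i _; rewrite mulrC. Qed.

Lemma dotDl u v w : dot (u + v) w = dot u w + dot v w.
Proof. by rewrite -big_split; apply: eq_bigr => i _; rewrite mxE mulrDl. Qed.

Lemma dotZl a u v : dot (a *: u) v = a * dot u v.
Proof. by rewrite mulr_sumr; apply: eq_bigr => i _; rewrite mxE mulrA. Qed.

Lemma dotNl u v : dot (- u) v = - dot u v.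
Proof. by rewrite -scaleN1r dotZl mulN1r. Qed.

Lemma dotDr u v w : dot u (v + w) = dot u v + dot u w.
Proof. by rewrite dotC dotDl !(dotC u). Qed.

Lemma dotZr a u v : dot u (a *: v) = a * dot u v.
Proof. by rewrite dotC dotZl dotC. Qed.

Lemma dotNr u v : dot u (- v) = - dot u v.
Proof. by rewrite dotC dotNl dotC. Qed.

Definition dotE := (dotDl, dotDr, dotNl, dotNr, dotZl, dotZr).

Lemma dot0l u : dot 0 u = 0.
Proof. by rewrite -(scale0r 0) dotZl mul0r. Qed.

Lemma dot_sumr u (m : nat) (f : nat -> 'rV[R]_n) :
  dot u (\sum_(0 <= j < m) f j) = \sum_(0 <= j < m) dot u (f j).
Proof.
elim: m => [|m IH]; first by rewrite !big_geq // dotC dot0l.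
by rewrite !big_nat_recr //= dotDr IH.
Qed.

Lemma dot_ge0 u : 0 <= dot u u.
Proof. by apply: sumr_ge0 => i _; rewrite -expr2 sqr_ge0. Qed.

Lemma enorm_ge0 u : 0 <= enorm u.
Proof. exact: sqrtr_ge0. Qed.

Lemma enorm_sqr u : enorm u ^+ 2 = dot u u.
Proof. by rewrite sqr_sqrtr ?dot_ge0. Qed.

Lemma enormN u : enorm (- u) = enorm u.
Proof. by rewrite /enorm !dotE opprK. Qed.

Lemma enormB u v : enorm (u - v) = enorm (v - u).
Proof. by rewrite -enormN opprB. Qed.

Lemma enormZ a u : enorm (a *: u) = `|a| * enorm u.
Proof.
by rewrite /enorm !dotE mulrA -expr2 sqrtrM ?sqr_ge0 // sqrtr_sqr.
Qed.

Lemma dot_eq0 u : dot u u = 0 -> u = 0.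
Proof.
move=> /eqP; rewrite psumr_eq0 => [|i _]; last by rewrite -expr2 sqr_ge0.
move=> /allP u0; apply/rowP => i; rewrite mxE.
by have /(_ (mem_index_enum i)) := u0 i; rewrite mulf_eq0 orbb => /eqP.
Qed.

(** Expand the square of [(v.v) u - (u.v) v]. *)
Lemma cauchy_schwarz u v : `|dot u v| <= enorm u * enorm v.
Proof.
rewrite -(@ler_pXn2r _ 2) ?nnegrE ?mulr_ge0 ?enorm_ge0 //.
rewrite real_normK ?num_real // exprMn !enorm_sqr.
have [v0|v0] := eqVneq (dot v v) 0.
  by rewrite (dot_eq0 v v0) dotC !dot0l expr0n mulr0.
have vv : 0 < dot v v by rewrite lt_def v0 dot_ge0.
have := dot_ge0 (dot v v *: u - dot u v *: v).
rewrite !dotE (dotC v u) => h.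
rewrite -(ler_pM2l vv); lra.
Qed.

Lemma dot_le u v : dot u v <= enorm u * enorm v.
Proof. exact: le_trans (ler_norm _) (cauchy_schwarz u v). Qed.

Lemma dot_ge u v : - (enorm u * enorm v) <= dot u v.
Proof. by have := cauchy_schwarz u v; rewrite ler_norml => /andP[]. Qed.

Lemma enormD u v : enorm (u + v) <= enorm u + enorm v.
Proof.
rewrite -(@ler_pXn2r _ 2) ?nnegrE ?addr_ge0 ?enorm_ge0 //.
rewrite enorm_sqr sqrrD !enorm_sqr !dotE (dotC v u).
have := dot_le u v; lra.
Qed.

Lemma enorm_continuous v : continuous (fun u : 'rV[R]_n => enorm (u - v)).
Proof.
have coordB i : continuous (fun u : 'rV[R]_n => (u - v) 0 i : R^o).
  have -> : (fun u : 'rV[R]_n => (u - v) 0 i) = (fun u => u 0 i - v 0 i).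
    by apply/funext => x; rewrite !mxE.
  by move=> u; apply: continuousB; [exact: coord_continuous | exact: cst_continuous].
have dotB : continuous (fun u : 'rV[R]_n => dot (u - v) (u - v) : R^o).
  apply: continuous_big => [|i _ u]; first exact: add_continuous.
  exact: continuousM (coordB i u) (coordB i u).
move=> u; apply: (continuous_comp (dotB u)).
exact: sqrt_continuous.
Qed.

End Euclidean.

(** * Compactness and convexity *)

(** Convergence enters through points of a sequence that are close to a cluster
    point in the Euclidean norm, so no comparison with the sup norm is
    made: only continuity of [enorm] links the two. *)
Section Topology.
Context {R : realType} {n : nat}.
Implicit Types (Y : set 'rV[R]_n) (u : nat -> 'rV[R]_n).

Lemma cluster_enorm u (p : 'rV[R]_n) (e : R) (N : nat) :
  cluster (u @ \oo) p -> 0 < e -> exists2 k, (N <= k)%N & enorm (u k - p) < e.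
Proof.
move=> up e0.
have near_p : nbhs p [set v | enorm (v - p) < e].
  have := @enorm_continuous R n p p; rewrite /continuous_at subrr.
  move=> /cvgr_lt; apply.
  by rewrite /enorm dot0l sqrtr0.
have tail : (u @ \oo) [set u k | k in [set k | (N <= k)%N]].
  by exists N => // k Nk; exists k.
by have [_ [[k Nk <-] kp]] := up _ _ tail near_p; exists k.
Qed.

Lemma cluster_closed Y u (p : 'rV[R]_n) (N : nat) : compact Y ->
  (forall k, (N <= k)%N -> Y (u k)) -> cluster (u @ \oo) p -> Y p.
Proof.
move=> cY uY up.
have clY : closed Y by apply: compact_closed => //; exact: norm_hausdorff.
apply: clY => B Bp.
have tail : (u @ \oo) Y by exists N => // k Nk; exact: uY.
exact: up.
Qed.

Lemma compact_cluster_seq Y u : compact Y -> (forall k, Y (u k)) ->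
  exists2 p, Y p & cluster (u @ \oo) p.
Proof.
move=> cY uY; have [|p [Yp up]] := cY (u @ \oo) _.
  by exists 0%N => // k _; exact: uY.
by exists p.
Qed.

Lemma compact_enorm_bounded Y : compact Y ->
  exists2 B : R, 0 <= B & forall v, Y v -> enorm v <= B.
Proof.
move=> cY; have [Y0|] := pselect (Y !=set0); last first.
  by move=> Y0; exists 0 => // v Yv; case: Y0; exists v.
have := @compact_EVT_max _ R (fun v : 'rV[R]_n => enorm (v - 0)) Y Y0 cY.
case=> [|c _ cmax]; first exact/continuous_subspaceT/enorm_continuous.
exists (enorm c); first exact: enorm_ge0.
by move=> v Yv; have := cmax v (mem_set Yv); rewrite !subr0.
Qed.

Lemma compact_diam Y : compact Y ->
  exists2 D : R, 0 <= D & forall v w, Y v -> Y w -> enorm (v - w) <= D.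
Proof.
move=> /compact_enorm_bounded[B B0 YB]; exists (B + B); first by rewrite addr_ge0.
move=> v w Yv Yw; apply: le_trans (enormD _ _) _.
by rewrite enormN lerD ?YB.
Qed.

Lemma convex_comb Y (a b : 'rV[R]_n) (t : R) : convex_set Y -> Y a -> Y b ->
  0 <= t <= 1 -> Y (t *: a + (1 - t) *: b).
Proof.
move=> cvY Ya Yb /andP[t0 t1].
by have := cvY a b (Itv01 t0 t1) (mem_set Ya) (mem_set Yb); rewrite inE.
Qed.

Lemma convex_segment Y (a b : 'rV[R]_n) (t : R) : convex_set Y -> Y a -> Y b ->
  0 <= t <= 1 -> Y (a + t *: (b - a)).
Proof.
move=> cvY Ya Yb t01; have := convex_comb _ b a t cvY Yb Ya t01.
by rewrite scalerBl scale1r scalerBr addrCA.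
Qed.

Lemma sum_gt0 (g : nat -> R) (m : nat) : (forall k, 0 < g k) ->
  0 < \sum_(0 <= j < m.+1) g j.
Proof.
move=> g0; elim: m => [|m IH]; first by rewrite big_nat1.
by rewrite big_nat_recr //= addr_gt0.
Qed.

Definition weighted_mean (g : nat -> R) u (m : nat) : 'rV[R]_n :=
  (\sum_(0 <= j < m.+1) g j)^-1 *: \sum_(0 <= j < m.+1) g j *: u j.

Lemma weighted_mean_in Y (g : nat -> R) u (m : nat) : convex_set Y ->
  (forall k, 0 < g k) -> (forall k, Y (u k)) -> Y (weighted_mean g u m).
Proof.
move=> cvY g0 uY; rewrite /weighted_mean; elim: m => [|m IH].
  by rewrite !big_nat1 scalerA mulVf ?gt_eqF // scale1r.
(* With [S] the sum of the first [m.+1] weights, the next mean combines the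
   current one and [u m.+1] with weights [S / (S + g m.+1)] and its complement. *)
rewrite !(big_nat_recr m.+1) //=.
have := sum_gt0 g m g0; set S := \sum_(0 <= j < m.+1) g j => S0.
have T0 : 0 < S + g m.+1 by rewrite addr_gt0.
have := convex_comb _ _ _ (S / (S + g m.+1)) cvY IH (uY m.+1).
rewrite scalerA scalerDr scalerA -/S.
have -> : S / (S + g m.+1) / S = (S + g m.+1)^-1 by field; lra.
have -> : 1 - S / (S + g m.+1) = (S + g m.+1)^-1 * g m.+1 by field; lra.
apply; apply/andP; split; first by rewrite divr_ge0 // ltW.
by rewrite ler_pdivrMr // mul1r lerDl ltW.
Qed.

Lemma dot_weighted_mean (g : nat -> R) u (v q : 'rV[R]_n) (m : nat) :
  (forall k, 0 < g k) ->
  (\sum_(0 <= j < m.+1) g j) * dot v (weighted_mean g u m - q) =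
  \sum_(0 <= j < m.+1) g j * dot v (u j - q).
Proof.
move=> g0; have S0 := sum_gt0 g m g0.
rewrite dotDr dotNr dotZr mulrBr mulrA divff ?gt_eqF // mul1r dot_sumr.
rewrite mulr_suml -sumrB; apply: eq_bigr => j _.
by rewrite dotZr dotDr dotNr mulrBr.
Qed.

End Topology.

(** * Euclidean projection *)

Section Projection.
Context {R : realType} {n : nat}.
Implicit Types (Y : set 'rV[R]_n) (v q : 'rV[R]_n).

(** This replaces passing to the limit [t -> 0] when a first-order expansion is
    divided by [t], or when an approximation error of order [t] is discarded. *)
Lemma ge0_of_vanishing_bound (a C : R) :
  (forall t, 0 < t <= 1 -> - (t * C) <= a) -> 0 <= a.
Proof.
move=> h; rewrite leNgt; apply/negP => a0.
have C1 : 0 < `|C| - a by rewrite subr_gt0 (lt_le_trans a0).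
(* This [t] is at most [1/2], and [t * C < - a]. *)
have /h : 0 < - a / (2 * (`|C| - a)) <= 1.
  rewrite divr_gt0 ?oppr_gt0 ?mulr_gt0 //= ler_pdivrMr ?mulr_gt0 // mul1r.
  have := normr_ge0 C; lra.
apply/negP; rewrite -ltNge ltrNr mulrC mulrA ltr_pdivrMr ?mulr_gt0 //.
have := ler_norm C; have := normr_ge0 C; nra.
Qed.

Lemma proj_spec Y v : Y !=set0 -> compact Y ->
  Y (Defs.proj Y v) /\ forall q, Y q -> enorm (v - Defs.proj Y v) <= enorm (v - q).
Proof.
move=> Y0 cY; apply: (@getPex _ [set p | Y p /\ _]).
have := @compact_EVT_min _ R (fun q : 'rV[R]_n => enorm (q - v)) Y Y0 cY.
case=> [|p Yp pmin]; first exact/continuous_subspaceT/enorm_continuous.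
exists p; split; first by rewrite inE in Yp.
by move=> q Yq; rewrite enormB (enormB v) pmin // inE.
Qed.

Lemma proj_in Y v : Y !=set0 -> compact Y -> Y (Defs.proj Y v).
Proof. by move=> Y0 cY; have [] := proj_spec Y v Y0 cY. Qed.

(** The point of [Y] at parameter [t] on the segment from the projection to
    [q] is no closer to [v] than the projection is. *)
Lemma proj_obtuse Y v q : Y !=set0 -> compact Y -> convex_set Y -> Y q ->
  dot (v - Defs.proj Y v) (q - Defs.proj Y v) <= 0.
Proof.
move=> Y0 cY cvY Yq; have [Yp pmin] := proj_spec Y v Y0 cY.
set p := Defs.proj Y v in Yp pmin *.
suff : 0 <= - (2 * dot (v - p) (q - p)) by lra.
apply: (ge0_of_vanishing_bound _ (dot (q - p) (q - p))) => t /andP[t0 t1].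
have t01 : 0 <= t <= 1 by rewrite t1 ltW.
have := pmin _ (convex_segment _ p q t cvY Yp Yq t01).
rewrite -(@ler_pXn2r _ 2) ?nnegrE ?enorm_ge0 // !enorm_sqr.
rewrite opprD addrA; move: (v - p) (q - p) => a b.
rewrite !dotE (dotC b a) => h.
rewrite -(ler_pM2l t0); lra.
Qed.

(** The angle at the projection between [v] and [q] is obtuse, so the side
    opposite to it is the longest. *)
Lemma proj_closer Y v q : Y !=set0 -> compact Y -> convex_set Y -> Y q ->
  dot (Defs.proj Y v - q) (Defs.proj Y v - q) <= dot (v - q) (v - q).
Proof.
move=> Y0 cY cvY Yq; have := proj_obtuse Y v q Y0 cY cvY Yq.
have -> : v - q = (v - Defs.proj Y v) + (Defs.proj Y v - q) by rewrite addrA subrK.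
set p := Defs.proj Y v; have -> : q - p = - (p - q) by rewrite opprB.
move: (v - p) (p - q) => a b.
rewrite !dotE (dotC b a); have := dot_ge0 a; lra.
Qed.

End Projection.

(** * Variational inequalities *)

Section VI.
Context {R : realType} {n : nat}.
Variables (H : 'rV[R]_n -> 'rV[R]_n) (Y : set 'rV[R]_n) (L : R).
Hypotheses (lipH : elipschitz_in L Y H) (cY : compact Y).

Lemma lipschitz_abs x y : Y x -> Y y -> enorm (H x - H y) <= `|L| * enorm (x - y).
Proof.
move=> Yx Yy; apply: le_trans (lipH x y Yx Yy) _.
by rewrite ler_wpM2r ?enorm_ge0 // ler_norm.
Qed.

Lemma lipschitz_bounded : exists2 M : R, 0 <= M & forall x, Y x -> enorm (H x) <= M.
Proof.
have [[x0 Yx0]|noY] := pselect (Y !=set0); last first.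
  by exists 0 => // x Yx; case: noY; exists x.
have [D D0 YD] := compact_diam Y cY.
exists (enorm (H x0) + `|L| * D) => [|x Yx].
  by rewrite addr_ge0 ?enorm_ge0 ?mulr_ge0.
have -> : H x = H x0 + (H x - H x0) by rewrite addrC subrK.
apply: le_trans (enormD _ _) _; rewrite lerD2l.
by apply: le_trans (lipschitz_abs _ _ Yx Yx0) _; rewrite ler_wpM2l // YD.
Qed.

(** Uniformity in [q] comes from the boundedness of [Y], which bounds both
    factors of the scalar product. *)
Lemma VI_lipschitz : exists2 K : R, 0 < K & forall x w q, Y x -> Y w -> Y q ->
  dot (H w) (q - w) <= dot (H x) (q - x) + K * enorm (w - x).
Proof.
have [M M0 HM] := lipschitz_bounded; have [D D0 YD] := compact_diam Y cY.
exists (`|L| * D + M + 1) => [|x w q Yx Yw Yq].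
  by rewrite ltr_wpDl // addr_ge0 ?mulr_ge0.
have -> : dot (H w) (q - w) = dot (H x) (q - x) + dot (H w - H x) (q - w)
            + dot (H x) (x - w) by rewrite !dotE; ring.
have h1 : dot (H w - H x) (q - w) <= (`|L| * enorm (w - x)) * D.
  apply: le_trans (dot_le _ _) _; apply: ler_pM; rewrite ?enorm_ge0 //.
    exact: lipschitz_abs.
  exact: YD.
have h2 : dot (H x) (x - w) <= M * enorm (w - x).
  apply: le_trans (dot_le _ _) _; rewrite enormB ler_wpM2r ?enorm_ge0 //.
  exact: HM.
have := enorm_ge0 (w - x); lra.
Qed.

Lemma VI_limit x q : Y x -> Y q ->
  (forall e, 0 < e ->
     exists w, [/\ Y w, enorm (w - x) < e & - e <= dot (H w) (q - w)]) ->
  0 <= dot (H x) (q - x).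
Proof.
move=> Yx Yq approx; have [K K0 HK] := VI_lipschitz.
apply: (ge0_of_vanishing_bound _ (1 + K)) => t /andP[t0 _].
have [w [Yw wx le_w]] := approx t t0.
have := HK x w q Yx Yw Yq.
have := ltW wx; rewrite -(ler_pM2l K0); lra.
Qed.

(** Minty's lemma.  Testing with the points [p + t (q - p)] of [Y] and dividing
    by [t] gives an inequality for [H (p + t (q - p))], hence for [H p] up to
    an error of order [t]. *)
Lemma minty p : convex_set Y -> Y p ->
  (forall q, Y q -> 0 <= dot (H q) (q - p)) ->
  forall q, Y q -> 0 <= dot (H p) (q - p).
Proof.
move=> cvY Yp weak q Yq.
apply: (ge0_of_vanishing_bound _ (`|L| * dot (q - p) (q - p))) => t /andP[t0 t1].
have Yt : Y (p + t *: (q - p)) by apply: convex_segment => //; rewrite ltW.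
have := weak _ Yt; have := lipschitz_abs _ _ Yt Yp.
rewrite addrAC subrr add0r enormZ (gtr0_norm t0) => lipt.
rewrite dotZr pmulr_rge0 // => pos.
have := dot_le (H (p + t *: (q - p)) - H p) (q - p).
have := ler_wpM2r (enorm_ge0 (q - p)) lipt.
rewrite -enorm_sqr dotDl dotNl; lra.
Qed.

Lemma VI_min_ge e x : Y !=set0 ->
  (forall q, Y q -> e <= dot (H x) (q - x)) -> e <= VI_min H Y x.
Proof.
move=> [q0 Yq0] ge_e; apply: lb_le_inf; first by exists (dot (H x) (q0 - x)), q0.
by move=> _ [q Yq <-]; exact: ge_e.
Qed.

Lemma VI_min_le x q : Y x -> Y q -> VI_min H Y x <= dot (H x) (q - x).
Proof.
move=> Yx Yq; apply: ge_inf; last by exists q.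
have [D D0 YD] := compact_diam Y cY.
exists (- (enorm (H x) * D)) => _ [y Yy <-].
apply: le_trans (dot_ge _ _); rewrite lerN2 ler_wpM2l ?enorm_ge0 //.
exact: YD.
Qed.

End VI.

Lemma Phi_lipschitz {R : realType} {n} (F G : 'rV[R]_n -> 'rV[R]_n) Y LF LG tau :
  elipschitz_in LF Y F -> elipschitz_in LG Y G ->
  elipschitz_in (LF + `|tau^-1| * LG) Y (Phi F G tau).
Proof.
move=> lipF lipG x y Yx Yy; rewrite /Phi opprD addrACA -scalerBr.
apply: le_trans (enormD _ _) _; rewrite mulrDl lerD ?lipF //.
by rewrite enormZ -mulrA ler_wpM2l ?lipG.
Qed.

Lemma Phi_monotone {R : realType} {n} (F G : 'rV[R]_n -> 'rV[R]_n) Y tau :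
  0 < tau -> monotone_in Y F -> monotone_in Y G -> monotone_in Y (Phi F G tau).
Proof.
move=> tau0 monF monG x y Yx Yy; rewrite /Phi opprD addrACA -scalerBr.
by rewrite dotDl dotZl addr_ge0 ?monF // mulr_ge0 ?monG // invr_ge0 ltW.
Qed.

(** * Averaged projection steps with a fixed operator *)

Section AveragedProjection.
Context {R : realType} {n : nat}.
Variables (H : 'rV[R]_n -> 'rV[R]_n) (Y : set 'rV[R]_n) (L : R).
Hypotheses (lipH : elipschitz_in L Y H) (monH : monotone_in Y H).
Hypotheses (Y0 : Y !=set0) (cvY : convex_set Y) (cY : compact Y).
Variables (g : nat -> R) (u : nat -> 'rV[R]_n).
Hypotheses (g0 : forall k, 0 < g k) (u0Y : Y (u 0%N)).
Hypothesis uS : forall k, u k.+1 = Defs.proj Y (u k - g k *: H (u k)).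

Lemma iterate_in k : Y (u k).
Proof. by case: k => [//|k]; rewrite uS; exact: proj_in. Qed.

(** The squared distance from [u (k+1)] to [q] is at most that from
    [u k - g k H(u k)]; expand the latter and sum over [k], so that the squared
    distances telescope. *)
Lemma regret_bound (M : R) (q : 'rV[R]_n) (m : nat) : Y q ->
  (forall x, Y x -> enorm (H x) <= M) ->
  2 * (\sum_(0 <= j < m) g j * dot (H (u j)) (u j - q))
    + enorm (u m - q) ^+ 2 <=
  enorm (u 0%N - q) ^+ 2 + M ^+ 2 * \sum_(0 <= j < m) g j ^+ 2.
Proof.
move=> Yq HM; elim: m => [|m IH]; first by rewrite !big_geq // !mulr0 add0r addr0.
rewrite !big_nat_recr //= uS.
have := proj_closer Y (u m - g m *: H (u m)) q Y0 cY cvY Yq.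
have HM2 : dot (H (u m)) (H (u m)) <= M ^+ 2.
  have := HM _ (iterate_in m); rewrite -enorm_sqr => Hm.
  by rewrite ler_pXn2r ?nnegrE ?enorm_ge0 // (le_trans _ Hm) ?enorm_ge0.
have := ler_wpM2l (sqr_ge0 (g m)) HM2.
have -> : u m - g m *: H (u m) - q = (u m - q) - g m *: H (u m) by rewrite addrAC.
move: IH; rewrite !enorm_sqr.
move: (H (u m)) (u m - q) (Defs.proj _ _ - q) => a b d IH HM2'.
rewrite (dotDl b) (dotDr b) (dotDr (- (g m *: a)))
  !dotNl !dotNr !dotZl !dotZr (dotC b a).
lra.
Qed.

(** Monotonicity replaces [H (u j)] by [H q], after which the sum is linear in
    the iterates and so is a multiple of its value at their mean. *)
Lemma weak_gap_bound (M : R) (q : 'rV[R]_n) (m : nat) : Y q ->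
  (forall x, Y x -> enorm (H x) <= M) ->
  2 * ((\sum_(0 <= j < m.+1) g j) * dot (H q) (weighted_mean g u m - q)) <=
  enorm (u 0%N - q) ^+ 2 + M ^+ 2 * \sum_(0 <= j < m.+1) g j ^+ 2.
Proof.
move=> Yq HM; apply: le_trans (regret_bound _ _ m.+1 Yq HM).
rewrite ler_wpDr ?sqr_ge0 // ler_pM2l // dot_weighted_mean //.
apply: ler_sum => j _; rewrite ler_pM2l //.
have := monH _ _ (iterate_in j) Yq; rewrite dotDl dotNl; lra.
Qed.

Hypothesis g_sum : (\sum_(0 <= k < K) g k) @[K --> \oo] --> +oo.
Hypothesis g_ratio :
  (\sum_(0 <= k < K.+1) g k ^+ 2) / (\sum_(0 <= k < K.+1) g k) @[K --> \oo] --> 0.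

Lemma weak_gap_vanishes (q : 'rV[R]_n) (e : R) : Y q -> 0 < e ->
  exists N, forall m, (N <= m)%N -> dot (H q) (weighted_mean g u m - q) <= e.
Proof.
move=> Yq e0; have [M M0 HM] := lipschitz_bounded H Y L lipH cY.
set D := enorm (u 0%N - q) ^+ 2.
(* Each of the two terms of the bound, divided by the sum of the steps, is made
   smaller than [e]; the factor 2 on the left absorbs both. *)
have [N1 _ sumN1] : \forall K \near \oo, D / e <= \sum_(0 <= k < K) g k.
  by move/cvgryPge: g_sum; apply.
have M1 : 0 < M ^+ 2 + 1 by rewrite ltr_wpDl ?sqr_ge0.
have [N2 _ ratioN2] : \forall K \near \oo,
    (\sum_(0 <= k < K.+1) g k ^+ 2) / (\sum_(0 <= k < K.+1) g k) <
      e / (M ^+ 2 + 1).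
  by move/cvgr_lt: g_ratio; apply; rewrite divr_gt0.
exists (maxn N1 N2) => m; rewrite geq_max => /andP[le1 le2].
have := sumN1 m.+1 (leqW le1); have := ratioN2 m le2; rewrite /=.
have := weak_gap_bound M q m Yq HM; rewrite -/D.
have := sum_gt0 g m g0.
move: (\sum_(0 <= j < m.+1) g j) (dot _ _) => S d S0.
have : 0 <= \sum_(0 <= j < m.+1) g j ^+ 2 by apply: sumr_ge0 => j _; exact: sqr_ge0.
move: (\sum_(0 <= j < m.+1) g j ^+ 2) => Q Q0 bound.
rewrite ltr_pdivrMr // mulrAC ltr_pdivlMr // => ratio.
rewrite ler_pdivrMr // => sumge.
rewrite -(ler_pM2l S0); lra.
Qed.

(** The means have a cluster point [p] in the compact set [Y].  It satisfies
    the weak inequality, hence by Minty's lemma the strong one, so the means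
    that come close to [p] violate the strong inequality by an arbitrarily
    small amount, uniformly in [q]. *)
Lemma mean_approx_solution (e : R) : 0 < e ->
  exists m, forall q, Y q ->
    - e <= dot (H (weighted_mean g u m.+1)) (q - weighted_mean g u m.+1).
Proof.
move=> e0; set z := weighted_mean g u.
have zY k : Y (z k) by apply: weighted_mean_in => //; exact: iterate_in.
have [p Yp zp] := compact_cluster_seq Y z cY zY.
have weak q : Y q -> 0 <= dot (H q) (q - p).
  move=> Yq; apply: (ge0_of_vanishing_bound _ (1 + enorm (H q))) => t /andP[t0 _].
  have [N zN] := weak_gap_vanishes q t Yq t0.
  have [k Nk kp] := cluster_enorm z p t N zp t0.
  have := zN k Nk; rewrite -/z; have := dot_ge (H q) (z k - p).
  have := ler_wpM2l (enorm_ge0 (H q)) (ltW kp).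
  have -> : dot (H q) (q - p) = dot (H q) (z k - p) - dot (H q) (z k - q).
    by rewrite !dotE; ring.
  lra.
have strong := minty H Y L lipH p cvY Yp weak.
have [K K0 HK] := VI_lipschitz H Y L lipH cY.
have [[//|k] _ kp] := cluster_enorm z p (e / K) 1 zp (divr_gt0 e0 K0).
exists k => q Yq; have := HK (z k.+1) p q (zY _) Yp Yq.
have := strong q Yq; move: kp; rewrite enormB ltr_pdivlMr //; lra.
Qed.

End AveragedProjection.

(** * The stages of the algorithm *)

Section Stages.
Context {R : realType} {n : nat}.
Variables (F G : 'rV[R]_n -> 'rV[R]_n) (Y : set 'rV[R]_n) (LF LG : R).
Hypotheses (lipG : elipschitz_in LG Y G) (monG : monotone_in Y G).
Hypotheses (lipF : elipschitz_in LF Y F) (monF : monotone_in Y F).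
Hypotheses (Y0 : Y !=set0) (cvY : convex_set Y) (cY : compact Y).
Variables (gamma epsbar taubar : nat -> R).
Hypotheses (gamma0 : forall k, 0 < gamma k) (tau0 : forall m, 0 < taubar m).
Hypothesis eps0 : forall m, 0 < epsbar m.
Hypothesis gamma_sum : (\sum_(0 <= k < K) gamma k) @[K --> \oo] --> +oo.
Hypothesis gamma_ratio :
  (\sum_(0 <= k < K.+1) gamma k ^+ 2) / (\sum_(0 <= k < K.+1) gamma k)
    @[K --> \oo] --> 0.
Variables (y z w : nat -> 'rV[R]_n) (i l : nat -> nat).
Hypothesis run : PATA F G Y gamma epsbar taubar y z w i l.

Let test m x := - epsbar m <= VI_min (Phi F G (taubar m)) Y x.

Lemma PATA_y_in k : Y (y k).
Proof.
case: k => [|k]; first exact: PATA_init_in run.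
by rewrite (PATA_y run); exact: proj_in.
Qed.

Lemma stage_mean k t : l (k + t)%N = k ->
  z (k + t).+1 = weighted_mean gamma (fun j => y (k + j)%N) t.+1.
Proof.
move=> lk; rewrite (PATA_z run) lk /weighted_mean.
have shift (V : nmodType) (f : nat -> V) :
    \sum_(k <= j < (k + t).+2) f j = \sum_(0 <= j < t.+2) f (k + j)%N.
  rewrite -{1}(add0n k) big_addn -!addnS addKn.
  by apply: eq_bigr => j _; rewrite addnC.
rewrite !shift; congr (_^-1 *: _).
  by apply: eq_bigr => j _; rewrite addKn.
by apply: eq_bigr => j _; rewrite addKn.
Qed.

(** A stage starts at an iteration [k] with [l k = k]. *)
Lemma stage_counters m k t : i k = m -> l k = k ->
  (forall s, (s < t)%N -> ~~ test m (z (k + s).+1)) ->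
  i (k + t)%N = m /\ l (k + t)%N = k.
Proof.
move=> ik lk; elim: t => [|t IH] fail; first by rewrite addn0.
have [it lt] := IH (fun s st => fail s (ltnW st)).
have := PATA_test run (k + t)%N; rewrite it lt addnS.
by rewrite -/(test _ _) (negbTE (fail t (ltnSn t))) => -[-> ->].
Qed.

(** If the test failed forever, the stage would be an infinite run of averaged
    projection steps with the fixed operator [Phi F G (taubar m)], and some mean
    would pass the test because [epsbar m] is positive. *)
Lemma stage_test_succeeds m k : i k = m -> l k = k ->
  exists t, test m (z (k + t).+1).
Proof.
move=> ik lk; apply: contrapT => never.
have fail t : ~~ test m (z (k + t).+1) by apply/negP => ok; apply: never; exists t.
have cnt t : i (k + t)%N = m /\ l (k + t)%N = k.
  by apply: stage_counters => // s _; exact: fail.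
pose u t := y (k + t)%N.
have uS t : u t.+1 = Defs.proj Y (u t - gamma t *: Phi F G (taubar m) (u t)).
  by rewrite /u addnS (PATA_y run); have [-> ->] := cnt t; rewrite addKn.
have lipP := Phi_lipschitz F G Y LF LG (taubar m) lipF lipG.
have monP := Phi_monotone F G Y (taubar m) (tau0 m) monF monG.
have [t ok] := mean_approx_solution (Phi F G (taubar m)) Y _ lipP monP Y0 cvY cY
  gamma u gamma0 (PATA_y_in _) uS gamma_sum gamma_ratio (epsbar m) (eps0 m).
apply: (negP (fail t)); have [it lt] := cnt t.
by rewrite stage_mean //; exact: VI_min_ge.
Qed.

Lemma stage_result m k : i k = m -> l k = k ->
  [/\ Y (w m.+1), test m (w m.+1) & exists k', i k' = m.+1 /\ l k' = k'].
Proof.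
move=> ik lk; have ex := stage_test_succeeds m k ik lk.
case: (ex_minnP ex) => t ok tmin.
have [it lt] : i (k + t)%N = m /\ l (k + t)%N = k.
  apply: stage_counters => // s st; apply/negP => /tmin.
  by rewrite leqNgt st.
have := PATA_test run (k + t)%N; rewrite it lt -/(test _ _) ok => -[-> iS lS].
split => //; last by exists (k + t).+1.
rewrite stage_mean //; apply: weighted_mean_in => // j; exact: PATA_y_in.
Qed.

(** The entry [w 0], which passes no test, is left out. *)
Lemma PATA_w m : Y (w m.+1) /\ test m (w m.+1).
Proof.
suff [k [ik lk]] : exists k, i k = m /\ l k = k.
  by have [] := stage_result m k ik lk.
elim: m => [|m [k [ik lk]]].
  by exists 0%N; rewrite (PATA_init_i run) (PATA_init_l run).
by have [] := stage_result m k ik lk.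
Qed.

Lemma PATA_w_gap m q : Y q ->
  - epsbar m <= dot (F (w m.+1)) (q - w m.+1)
                + (taubar m)^-1 * dot (G (w m.+1)) (q - w m.+1).
Proof.
move=> Yq; have [Yw ok] := PATA_w m.
have := VI_min_le (Phi F G (taubar m)) Y cY (w m.+1) q Yw Yq.
by rewrite dotDl dotZl; exact: le_trans.
Qed.

End Stages.

(** The powers of [tau] combine to [eps * tau = c * (tau^-1) `^ (beta - 1)],
    whose exponent is positive. *)
Lemma tolerance_vanishes (R : realType) (tau : nat -> R) (c beta : R) :
  1 < beta -> (forall m, 0 < tau m) -> (tau m)^-1 @[m --> \oo] --> 0 ->
  c / (tau m `^ beta) * tau m @[m --> \oo] --> 0.
Proof.
move=> beta1 tau0 tau_lim.
have -> : (fun m => c / (tau m `^ beta) * tau m) =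
    (fun m => c * (tau m)^-1 `^ (beta - 1)).
  apply/funext => m; rewrite -mulrA; congr (_ * _).
  rewrite -(powR_inv1 (ltW (tau0 m))) -powRrM mulN1r opprB powRB ?(lt_eqF beta1) //.
  by rewrite powRr1 ?ltW // mulrC.
suff pow_lim : (tau m)^-1 `^ (beta - 1) @[m --> \oo] --> (0 : R).
  have -> : (0 : R) = c * 0 by rewrite mulr0.
  exact: cvgMl_tmp.
apply/cvgr0Pnorm_lt => e e0; have b1 : 0 < beta - 1 by rewrite subr_gt0.
have d0 : 0 < e `^ (beta - 1)^-1 by rewrite powR_gt0.
move/cvgr0Pnorm_lt: tau_lim => /(_ _ d0); apply: filterS => m.
rewrite ger0_norm ?invr_ge0 ?ltW // ger0_norm ?powR_ge0 // => small.
have := @gt0_ltr_powR R _ b1 (tau m)^-1 (e `^ (beta - 1)^-1).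
rewrite -powRrM mulVf ?gt_eqF // powRr1 ?ltW //.
apply => //; rewrite ?nnegrE ?invr_ge0 ?ltW //.
Qed.

(** * Cluster points of the outputs *)

Section Conclusion.
Context {R : realType} {n : nat}.
Variables (F G : 'rV[R]_n -> 'rV[R]_n) (Y : set 'rV[R]_n) (LF LG : R).
Hypotheses (lipG : elipschitz_in LG Y G) (lipF : elipschitz_in LF Y F).
Hypotheses (monF : monotone_in Y F) (cY : compact Y).
Variables (eps tau : nat -> R) (w : nat -> 'rV[R]_n).
Hypotheses (tau0 : forall m, 0 < tau m).
Hypothesis tau_lim : (tau m)^-1 @[m --> \oo] --> 0.
Hypothesis eps_tau_lim : eps m * tau m @[m --> \oo] --> 0.
Hypothesis wY : forall m, Y (w m.+1).
Hypothesis w_gap : forall m q, Y q ->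
  - eps m <= dot (F (w m.+1)) (q - w m.+1)
              + (tau m)^-1 * dot (G (w m.+1)) (q - w m.+1).

Lemma cluster_shift_near x e d : cluster (w @ \oo) x -> 0 < e -> 0 < d ->
  exists m, [/\ enorm (w m.+1 - x) < e, (tau m)^-1 < d & eps m * tau m < d].
Proof.
move=> wx e0 d0.
have [N1 _ tauN] : \forall m \near \oo, (tau m)^-1 < d.
  by move/cvgr_lt: tau_lim; apply.
have [N2 _ epsN] : \forall m \near \oo, eps m * tau m < d.
  by move/cvgr_lt: eps_tau_lim; apply.
have [[//|m] Nm close] := cluster_enorm w x e (maxn N1 N2).+1 wx e0.
move: Nm; rewrite ltnS geq_max => /andP[le1 le2].
by exists m; split=> //; [exact: tauN | exact: epsN].
Qed.

(** Since [G(w)^T (q - w)] stays bounded, its factor [tau_m^-1] makes the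
    second term of the test vanish.  The tolerance is recovered as
    [eps_m = (eps_m tau_m) tau_m^-1], which is below [tau_m^-1] once
    [eps_m tau_m < 1]. *)
Lemma limit_lower_level x q : cluster (w @ \oo) x -> Y x -> Y q ->
  0 <= dot (F x) (q - x).
Proof.
move=> wx Yx Yq; apply: (VI_limit F Y LF lipF cY) => // e e0.
have [M M0 GM] := lipschitz_bounded G Y LG lipG cY.
have [D D0 YD] := compact_diam Y cY.
(* [tau_m^-1 < e / (1 + M * D)] controls the tolerance and the [G]-term, which
   is at most [tau_m^-1 * (M * D)], together. *)
have K0 : 0 < 1 + M * D by rewrite ltr_pwDl // mulr_ge0.
have d0 : 0 < Num.min 1 (e / (1 + M * D)).
  by rewrite lt_min ltr01 divr_gt0.
have [m [close]] := cluster_shift_near x e _ wx e0 d0.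
rewrite !lt_min => /andP[_ tau_small] /andP[eps1 _].
exists (w m.+1); split=> //.
have := w_gap m q Yq.
have Gle : dot (G (w m.+1)) (q - w m.+1) <= M * D.
  apply: le_trans (dot_le _ _) _.
  by apply: ler_pM; rewrite ?enorm_ge0 //; [exact: GM | exact: YD].
have ti0 : 0 < (tau m)^-1 by rewrite invr_gt0.
have := ler_wpM2l (ltW ti0) Gle.
have : eps m < (tau m)^-1 by rewrite -(ltr_pM2r (tau0 m)) mulVf ?gt_eqF.
move: tau_small; rewrite ltr_pdivlMr //; lra.
Qed.

(** For [q] solving the lower problem, monotonicity of [F] makes the [F]-term of
    the test nonpositive, so multiplying the test by [tau m] leaves an
    inequality for [G] alone with error [eps m * tau m]. *)
Lemma limit_upper_level x q : cluster (w @ \oo) x -> Y x -> SOL F Y q ->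
  0 <= dot (G x) (q - x).
Proof.
move=> wx Yx [Yq Fq]; apply: (VI_limit G Y LG lipG cY) => // e e0.
have [m [close _ eps_small]] := cluster_shift_near x e e wx e0 e0.
exists (w m.+1); split=> //.
have := w_gap m q Yq; rewrite -(ler_pM2r (tau0 m)) mulrDl mulrAC mulVf ?gt_eqF //.
have Fle : dot (F (w m.+1)) (q - w m.+1) <= 0.
  have := monF _ _ (wY m) Yq; have := Fq _ (wY m).
  by rewrite -[q - _]opprB dotNr dotDl dotNl; lra.
have := ler_wpM2r (ltW (tau0 m)) Fle; lra.
Qed.

End Conclusion.

Theorem theorem1 (R : realType) (n : nat) (F G : 'rV[R]_n -> 'rV[R]_n)
    (Y : set 'rV[R]_n) (LF LG : R)
    (hG_lip : elipschitz_in LG Y G) (hG_mono : monotone_in Y G)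
    (hF_lip : elipschitz_in LF Y F) (hF_mono : monotone_in Y F)
    (hY0 : Y !=set0) (hY_convex : convex_set Y) (hY_compact : compact Y)
    (gamma epsbar taubar : nat -> R) (c beta : R)
    (hgamma : forall k, 0 < gamma k <= 1)
    (htau : forall i, 0 < taubar i)
    (heps : forall i, 0 <= epsbar i)
    (hgamma_sum : (\sum_(0 <= k < K) gamma k) @[K --> \oo] --> +oo)
    (hgamma_ratio :
      (\sum_(0 <= k < K.+1) gamma k ^+ 2) / (\sum_(0 <= k < K.+1) gamma k)
        @[K --> \oo] --> 0)
    (htau_noninc : nonincreasing_seq (fun i => (taubar i)^-1))
    (htau_lim : (taubar i)^-1 @[i --> \oo] --> 0)
    (htau_sum : (\sum_(0 <= i < N) (taubar i)^-1) @[N --> \oo] --> +oo)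
    (hbeta : 1 < beta) (hc : 0 < c)
    (heps_def : forall i, epsbar i = c / (taubar i `^ beta))
    (y z w : nat -> 'rV[R]_n) (i l : nat -> nat)
    (hPATA : PATA F G Y gamma epsbar taubar y z w i l) :
  cluster (w @ \oo) `<=` SOL G (SOL F Y).
Proof.
have gamma0 k : 0 < gamma k by have /andP[] := hgamma k.
have eps0 m : 0 < epsbar m by rewrite heps_def divr_gt0 // powR_gt0.
have stage := PATA_w F G Y LF LG hG_lip hG_mono hF_lip hF_mono hY0 hY_convex
  hY_compact gamma epsbar taubar gamma0 htau eps0 hgamma_sum hgamma_ratio
  y z w i l hPATA.
have w_gap := PATA_w_gap F G Y LF LG hG_lip hG_mono hF_lip hF_mono hY0 hY_convex
  hY_compact gamma epsbar taubar gamma0 htau eps0 hgamma_sum hgamma_ratio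
  y z w i l hPATA.
have wY m : Y (w m.+1) by have [] := stage m.
have eps_tau : epsbar m * taubar m @[m --> \oo] --> 0.
  have -> : epsbar = fun m => c / (taubar m `^ beta) by apply/funext.
  exact: tolerance_vanishes.
move=> x wx.
have Yx : Y x by apply: (cluster_closed Y w x 1 hY_compact) => // -[|k].
split; first split=> // q Yq.
  exact: (limit_lower_level F G Y LF LG hG_lip hF_lip hY_compact epsbar taubar w).
move=> q Fq.
exact: (limit_upper_level F G Y LG hG_lip hF_mono hY_compact epsbar taubar w).
Qed.
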